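(* For every Hausdorff space $X$, $\chi(\mathcal{S}(X))=\chi(X)$.
   Context: For a Hausdorff space $X$, $\mathcal{S}(X)$ is the set of all nonempty subsets of $X$ that are unions of finitely many convergent sequences of $X$, where a convergent sequence is understood as a set $\{x_j:j\in\mathbb{N}\}\cup\{x\}$ with $x_j\to x$ in $X$ (trivial, i.e. constant, sequences allowed). $\mathcal{S}(X)$ carries the Vietoris topology, whose basic open sets are $\langle U_1,\dots,U_r\rangle=\{S\in\mathcal{S}(X): S\subset\bigcup_{i=1}^r U_i \text{ and } S\cap U_j\neq\emptyset \text{ for } 1\le j\le r\}$ with $r\in\mathbb{N}$ and $U_1,\dots,U_r$ open in $X$. The character of a space $Y$ is $\chi(Y)=\sup\{\chi(y,Y):y\in Y\}$, where $\chi(y,Y)=\omega+\min\{|\mathcal{U}|:\mathcal{U}\text{ is a neighborhood base of }y\text{ in }Y\}$. *)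

(* Defs.v *)
From HB Require Import structures.
From mathcomp Require Import all_boot.
From mathcomp Require Import all_classical topology.

Set Implicit Arguments.
Unset Strict Implicit.
Unset Printing Implicit Defensive.

Local Open Scope classical_set_scope.
Local Open Scope card_scope.

(* A cardinal number is represented by a type with that many elements, and
   cardinals are compared with #<= and #=.  Minima of nonempty families and
   suprema of arbitrary families exist, as shown below, so a representative can
   be chosen without any default value; it is unique up to #=. *)

Lemma card_leTP (T U : Type) :
  [set: T] #<= [set: U] <-> exists f : T -> U, injective f.
Proof.
split=> [/card_leP[f]|[f fI]].
  exists (fun x => \val (f (SigSub (mem_set (I : [set: T] x))))) => x y.
  by move=> /val_inj /(inj (mem_set I) (mem_set I)) /(congr1 val).
apply: (@card_le_trans _ _ _ (f @` [set: T])); last exact: card_leT.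
have : f @` [set: T] #= [set: T] by apply: inj_card_eq => x y _ _ /fI.
by rewrite card_eq_le => /andP[].
Qed.

Lemma card_min_exists (I : Type) (i0 : I) (F : I -> Type) :
  exists i, forall j, [set: F i] #<= [set: F j].
Proof.
pose P (A : set (forall i, F i)) :=
  forall s t i, A s -> A t -> s i = t i -> s = t.
have [|A [PA Amax]] := @Zorn_bigcup _ P.
  move=> C CP Ctot s t i [B CB Bs] [D CD Dt].
  have [BD|DB] := Ctot _ _ CB CD.
    by apply: (CP _ CD) => //; exact: BD.
  by apply: (CP _ CB) => //; exact: DB.
have [[i Ai]|noti] := pselect (exists i, forall x : F i, exists s, A s /\ s i = x).
  exists i => j; apply/card_leTP.
  have [g gP] := choice Ai; exists (fun x => g x j) => x y gxy.
  have [Agx <-] := gP x; have [Agy <-] := gP y.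
  by rewrite (PA _ _ j Agx Agy gxy).
have tP i : exists x : F i, forall s, A s -> s i <> x.
  have [//|/forallNP h] := pselect (exists x : F i, forall s, A s -> s i <> x).
  exfalso; apply: noti; exists i => x; have /existsNP[s /not_implyP[As /contrapT sx]] := h x.
  by exists s.
pose t i := sval (cid (tP i)).
have tA s i : A s -> s i <> t i by move=> As; exact: (svalP (cid (tP i)) s As).
have [] := Amax (A `|` [set t]).
  split; last by move=> h; apply: (tA t i0) => //; apply: h; right.
  by move=> s; left.
move=> s s' i [As|->] [As'|->] //; first exact: PA.
  by move=> /(tA _ _ As).
by move=> /esym/(tA _ _ As').
Qed.

Definition is_card_sup (I : Type) (F : I -> Type) (K : Type) :=
  (forall i, [set: F i] #<= [set: K]) /\
  (forall L : Type, (forall i, [set: F i] #<= [set: L]) -> [set: K] #<= [set: L]).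

Lemma card_sup_exists (I : Type) (F : I -> Type) : exists K, is_card_sup F K.
Proof.
pose S := {i & F i}.
have FS i : exists f : F i -> S, injective f.
  exists (existT F i) => x y e; move: (projT2_eq e).
  by rewrite (Prop_irrelevance (projT1_eq e) erefl).
pose J := {A : set S | forall i, [set: F i] #<= A}.
have ubJ (L : Type) (h : L -> S) : injective h ->
    (forall i, [set: F i] #<= [set: L]) -> exists A : J, sval A #<= [set: L].
  move=> hI FL; have hL : range h #= [set: L] by apply: inj_card_eq => x y _ _ /hI.
  have FA i : [set: F i] #<= range h by rewrite (card_le_eqr hL).
  by exists (exist _ _ FA) => /=; move: hL; rewrite card_eq_le => /andP[].
have [A0 _] := ubJ S id (fun _ _ => id) (fun i => (card_leTP _ _).2 (FS i)).
have [A minA] := card_min_exists A0 (fun A : J => set_type (sval A)).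
exists (set_type (sval A)); split=> [i|L FL].
  by rewrite (card_le_eqr (card_setT _)); exact: (svalP A).
pose H (o : option J) : Type := if o is Some B then set_type (sval B) else L.
have [[B|] minB] := card_min_exists None H.
  exact: card_le_trans (minA B) (minB None).
have LA0 : [set: L] #<= sval A0.
  by have := minB (Some A0); rewrite /= (card_le_eqr (card_setT _)).
have /card_leTP[h hI] := card_le_trans LA0 (card_leT (sval A0)).
have [B BL] := ubJ L h hI FL.
by apply: card_le_trans (minA B) _; rewrite (card_le_eql (card_setT _)).
Qed.

Definition card_sup (I : Type) (F : I -> Type) : Type :=
  sval (cid (card_sup_exists F)).

Definition nbhs_base (Y : topologicalType) (y : Y) (B : set (set Y)) :=
  B `<=` nbhs y /\ forall N, nbhs y N -> exists2 U, B U & U `<=` N.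

Lemma min_nbhs_base_exists (Y : topologicalType) (y : Y) :
  exists B, nbhs_base y B /\ forall B', nbhs_base y B' -> B #<= B'.
Proof.
have nB : nbhs_base y (nbhs y) by split=> // N yN; exists N.
have [[B yB] minB] := card_min_exists (exist (nbhs_base y) _ nB)
  (fun B : {B | nbhs_base y B} => set_type (sval B)).
exists B; split=> // B' yB'; have := minB (exist _ B' yB').
by rewrite /= (card_le_eql (card_setT _)) (card_le_eqr (card_setT _)).
Qed.

Definition min_nbhs_base (Y : topologicalType) (y : Y) : set (set Y) :=
  sval (cid (min_nbhs_base_exists y)).

(* The cardinal sum of omega and the least cardinality of a base at y. *)
Definition character_at (Y : topologicalType) (y : Y) : Type :=
  (nat + set_type (min_nbhs_base y))%type.

Definition character (Y : topologicalType) : Type :=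
  card_sup (@character_at Y).

Definition is_convergent_seq (X : topologicalType) (C : set X) :=
  exists (u : nat -> X) (x : X), u @ \oo --> x /\ C = range u `|` [set x].

Definition is_fin_union_seq (X : topologicalType) (S : set X) :=
  S !=set0 /\ exists (r : nat) (C : 'I_r -> set X),
    (forall i, is_convergent_seq (C i)) /\ S = \bigcup_i C i.

Record seq_hyperspace (X : topologicalType) := SeqHyperspace {
  seq_hyperspace_set :> set X;
  seq_hyperspaceP : is_fin_union_seq seq_hyperspace_set }.

HB.instance Definition _ (X : topologicalType) := gen_eqMixin (seq_hyperspace X).
HB.instance Definition _ (X : topologicalType) :=
  gen_choiceMixin (seq_hyperspace X).

(* For r = 0 the box is empty, because elements of the hyperspace are nonempty. *)
Definition vietoris_box (X : topologicalType) (r : nat) (U : 'I_r -> set X) :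
    set (seq_hyperspace X) :=
  [set S : seq_hyperspace X |
    S `<=` \bigcup_i U i /\ forall j, (S : set X) `&` U j !=set0].

Definition vietoris_base (X : topologicalType) : set (set (seq_hyperspace X)) :=
  [set W | exists (r : nat) (U : 'I_r -> set X),
    (forall i, open (U i)) /\ W = vietoris_box U].

Lemma vietoris_base_cover (X : topologicalType) :
  \bigcup_(W in @vietoris_base X) W = setT.
Proof.
apply/seteqP; split=> // S _; exists (vietoris_box (fun _ : 'I_1 => setT)).
  by exists 1, (fun=> setT); split=> // i; exact: openT.
split=> [x _|_]; first by exists ord0.
by have [[x Sx] _] := seq_hyperspaceP S; exists x.
Qed.

Lemma vietoris_base_join (X : topologicalType) (W1 W2 : set (seq_hyperspace X)) S :
  vietoris_base W1 -> vietoris_base W2 -> W1 S -> W2 S ->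
  exists W, [/\ vietoris_base W, W S & W `<=` W1 `&` W2].
Proof.
move=> [r1 [U1 [oU1 ->]]] [r2 [U2 [oU2 ->]]] [SU1 U1S] [SU2 U2S].
pose U (i : 'I_(r1 + r2)) := match fintype.split i with
  | inl j => U1 j `&` \bigcup_k U2 k | inr j => U2 j `&` \bigcup_k U1 k end.
have Ul j : U (lshift r2 j) = U1 j `&` \bigcup_k U2 k.
  by rewrite /U -[lshift r2 j]/(unsplit (inl j)) unsplitK.
have Ur j : U (rshift r1 j) = U2 j `&` \bigcup_k U1 k.
  by rewrite /U -[rshift r1 j]/(unsplit (inr j)) unsplitK.
exists (vietoris_box U); split.
- exists (r1 + r2), U; split=> // i; rewrite /U.
  by case: (fintype.split i) => j; apply: openI => //; apply: bigcup_open.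
- split=> [x Sx|i].
    have [j _ U1x] := SU1 x Sx.
    by exists (lshift r2 j) => //; rewrite Ul; split=> //; exact: SU2.
  rewrite /U; case: (fintype.split i) => j.
    by have [x [Sx Ux]] := U1S j; exists x; split=> //; split=> //; exact: SU2.
  by have [x [Sx Ux]] := U2S j; exists x; split=> //; split=> //; exact: SU1.
move=> T [TU UT]; split; split.
- move=> x /TU[i _]; rewrite /U; case: (fintype.split i) => j []//.
  by exists j.
- by move=> j; have [x [Tx]] := UT (lshift r2 j); rewrite Ul => -[Ux _]; exists x.
- move=> x /TU[i _]; rewrite /U; case: (fintype.split i) => j []//.
  by exists j.
- by move=> j; have [x [Tx]] := UT (rshift r1 j); rewrite Ur => -[Ux _]; exists x.
Qed.

HB.instance Definition _ (X : topologicalType) :=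
  isBaseTopological.Build (seq_hyperspace X)
    (@vietoris_base_cover X) (@vietoris_base_join X).

(* Main.v *)
Require Import Defs.
From mathcomp Require Import all_boot.
From mathcomp Require Import all_classical topology.

Local Open Scope classical_set_scope.
Local Open Scope card_scope.

(** Both inequalities compare local bases, and a cardinal bounds the character
of a space as soon as it is infinite and indexes a base at every point
([character_leP], [character_at_leP]).

The map sending x to {x} embeds X into its hyperspace, so a base at {x} pulls
back to a base at x ([hyperspace_point_indexed_base]); this gives
chi(X) <= chi(S(X)).

For the converse, let K be the character of X and fix a base indexed by K at
each point of X.  A finite union S of convergent sequences is countable, and it
is compact: a neighbourhood of a limit leaves out only finitely many terms.  If
<W_1, ..., W_r> is a neighbourhood of S, choose around each x in S a basic
neighbourhood lying in every W_j that contains x.  Finitely many of these cover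
S, and together with one of them inside each W_j they form a box around S that
lies in <W_1, ..., W_r> ([vietoris_seq_box_refine]).  Hence the boxes made of
finitely many basic sets at points of S form a base at S, indexed by finite
lists of pairs in K * K, as K is large enough to enumerate S
([hyperspace_indexed_base]).

It remains to count those lists: an infinite set K has no more finite lists than
elements ([card_seq_le]).  By Zorn's lemma, there is a maximal subset A of K
together with an injection from the lists over A to A.  If the complement of A
embeds in A, then so does K, and lists over K are coded by lists over A.
Otherwise A embeds in its complement, and adjoining the image of A to A
extends the coding, against maximality. *)

(** * Cardinal comparison *)

Lemma card_le_fun {T U : Type} {A : set T} {B : set U} :
  A #<= B -> B !=set0 ->
  exists h : T -> U, (forall x, A x -> B (h x)) /\
    (forall x y, A x -> A y -> h x = h y -> x = y).
Proof.
elim/Ppointed: U => U in B *; first by move=> _ [b]; case: (no b).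
move=> /pcard_leP[h] _; exists h; split=> [x|x y Ax Ay]; first exact: funS.
by apply: inj; apply: mem_set.
Qed.

Lemma card_le_range {T U : Type} {A : set T} :
  A #<= [set: U] -> A !=set0 -> exists s : U -> T, range s = A.
Proof.
move=> /pfcard_geP[->[]//|[s] _]; exists s; apply/seteqP; split.
  by move=> _ [x _ <-]; exact: funS.
by move=> x Ax; have [y _ <-] := @surj _ _ _ _ s x Ax; exists y.
Qed.

(** A least cardinal exists in any family of types, in particular among two. *)
Lemma card_le_total {T U : Type} (A : set T) (B : set U) :
  A #<= B \/ B #<= A.
Proof.
pose F b : Type := if b then set_type A else set_type B.
have [b minb] := card_min_exists true F.
case: b minb => [/(_ false)|/(_ true)]; rewrite /= (card_le_eql (card_setT _));
  rewrite (card_le_eqr (card_setT _)); by [left|right].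
Qed.

(** * Lists over an infinite set *)

(** The coding is total on [seq K], constrained only on lists over [A], so that
codings for different sets [A] have the same type and can be compared. *)
Definition list_coding {K : Type} (A : set K) (f : seq K -> K) :=
  (forall l, all (mem A) l -> A (f l)) /\
  (forall l m, all (mem A) l -> all (mem A) m -> f l = f m -> l = m).

Lemma all_memS {K : Type} (A B : set K) (l : seq K) :
  A `<=` B -> all (mem A) l -> all (mem B) l.
Proof. by move=> AB; apply: sub_all => x /set_mem/AB/mem_set. Qed.

Lemma map_inj_on {K L : Type} (A : set K) (g : K -> L) :
  (forall x y, A x -> A y -> g x = g y -> x = y) ->
  forall l m, all (mem A) l -> all (mem A) m -> map g l = map g m -> l = m.
Proof.
move=> gI; elim=> [|x l IH] [|y m] //= /andP[/set_mem Ax Al] /andP[/set_mem Ay Am].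
by move=> [/gI-> // /IH->].
Qed.

(** A coding forces [A] to absorb any set [B] that embeds in it: the codes of
one-element lists provide a copy of [A], and the codes of two-element lists a
disjoint copy of [B]. *)
Lemma list_coding_absorb {K : Type} (A B : set K) (f : seq K -> K) (h : K -> K) :
  list_coding A f ->
  (forall x, B x -> A (h x)) -> (forall x y, B x -> B y -> h x = h y -> x = y) ->
  exists g : K -> K, (forall x, (A `|` B) x -> A (g x)) /\
    (forall x y, (A `|` B) x -> (A `|` B) y -> g x = g y -> x = y).
Proof.
move=> [fA fI] hA hI.
pose c x := if x \in A then [:: x] else [:: h x; h x].
have cA x : (A `|` B) x -> all (mem A) (c x).
  rewrite /c; case: ifPn => [xA _ /=|xA]; first by rewrite andbT.
  by move=> [/mem_set|/hA/mem_set hx]; rewrite ?(negPf xA) //= hx.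
exists (f \o c); split=> [x /cA/fA //|x y ABx ABy /= /fI].
move=> /(_ (cA x ABx) (cA y ABy)); rewrite /c.
case: ifPn => xA; case: ifPn => yA //; first by case.
case: ABx => [/mem_set|Bx]; first by rewrite (negPf xA).
case: ABy => [/mem_set|By]; first by rewrite (negPf yA).
by case=> e; apply: hI.
Qed.

(** Since [A] absorbs its copy [h @` A], lists over the union can be coded in [A];
moving these codes to the copy by [h] keeps them apart from the codes of lists
over [A], which can therefore be left unchanged. *)
Lemma list_coding_extend {K : Type} (A : set K) (f : seq K -> K) (h : K -> K) :
  list_coding A f ->
  (forall x, A x -> ~ A (h x)) -> (forall x y, A x -> A y -> h x = h y -> x = y) ->
  exists f', list_coding (A `|` h @` A) f' /\
    forall l, all (mem A) l -> f' l = f l.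
Proof.
move=> fA hA hI; set B := h @` A.
have /choice[k kP] y : exists x, B y -> A x /\ h x = y.
  by have [[x Ax <-]|nBy] := pselect (B y); [exists x|exists y].
have [||g [gA gI]] := list_coding_absorb A B f k fA.
- by move=> x /kP[].
- by move=> x y /kP[_ {2}<-] /kP[_ {2}<-] ->.
have [cA cI] := fA.
have gAl l : all (mem (A `|` B)) l -> all (mem A) (map g l).
  by rewrite all_map; apply: sub_all => x /set_mem/gA/mem_set.
pose f' l := if all (mem A) l then f l else h (f (map g l)).
exists f'; split; last by move=> l Al; rewrite /f' Al.
split=> [l ABl|l m ABl ABm]; rewrite /f'.
  case: ifP => [/cA|_]; first by left.
  by right; exists (f (map g l)) => //; exact/cA/gAl.
case: ifPn => Al; case: ifPn => Am.
- exact: cI.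
- by move=> e; case: (hA (f (map g m))); [exact/cA/gAl|rewrite -e; exact: cA].
- by move=> e; case: (hA (f (map g l))); [exact/cA/gAl|rewrite e; exact: cA].
- by move=> /hI/cI e; apply: (map_inj_on _ _ gI) => //;
    apply: e => //; do ?apply: cA; exact: gAl.
Qed.

(** A finite list over the union of a chain is already a list over one of its
members, and all members containing it agree on its code. *)
Lemma list_coding_chain {K : Type} (C : set (set K * (seq K -> K))) :
  (forall p, C p -> list_coding p.1 p.2) ->
  total_on C (fun p q =>
    p.1 `<=` q.1 /\ forall l, all (mem p.1) l -> q.2 l = p.2 l) ->
  C !=set0 ->
  exists2 q, list_coding q.1 q.2 & forall p, C p ->
    p.1 `<=` q.1 /\ forall l, all (mem p.1) l -> q.2 l = p.2 l.
Proof.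
move=> Ccode Ctot [p0 Cp0]; pose A := \bigcup_(p in C) p.1.
have inC l : all (mem A) l -> exists2 p, C p & all (mem p.1) l.
  elim: l => [_|x l IH /= /andP[/set_mem[p Cp px] /IH[q Cq ql]]]; first by exists p0.
  have [[pq _]|[qp _]] := Ctot _ _ Cp Cq.
    by exists q => //; rewrite ql (mem_set (pq _ px)).
  by exists p => //; rewrite (all_memS _ _ _ qp ql) (mem_set px).
have /choice[F FP] l : exists p, all (mem A) l -> C p /\ all (mem p.1) l.
  by have [/inC[p]|] := boolP (all (mem A) l); [exists p|exists p0].
have FE p l : C p -> all (mem p.1) l -> (F l).2 l = p.2 l.
  move=> Cp pl; have [|CF Fl] := FP l; first by apply: all_memS pl => x; exists p.
  by have [[_ ->]|[_ ->]] := Ctot _ _ CF Cp.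
exists (A, fun l => (F l).2 l) => /=; last first.
  by move=> p Cp; split=> [x|l]; [exists p|exact: FE].
split=> [l /FP[CF Fl]|l m Al Am].
  by exists (F l) => //; exact: (Ccode _ CF).1.
(* Injectivity involves two lists; concatenating them finds a common member. *)
have [p Cp /andP[pl pm]] : exists2 p, C p & all (mem p.1) l && all (mem p.1) m.
  by have [|p] := inC (l ++ m); rewrite all_cat; [exact/andP|exists p].
by rewrite !(FE p) //; exact: (Ccode _ Cp).2.
Qed.

(** For uncountable [K] this rests on the axiom of choice, through the maximal
coding that Zorn's lemma provides. *)
Lemma card_seq_le (K : Type) : [set: nat] #<= [set: K] -> [set: seq K] #<= [set: K].
Proof.
move=> /card_leTP[n nI].
(* A coding of lists of naturals starts the construction: it is also the upper
   bound of the empty chain. *)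
have n_code : exists f, list_coding (range n) f.
  have /choice[k kP] x : exists i, range n x -> n i = x.
    by have [[i _ <-]|] := pselect (range n x); [exists i|exists 0].
  exists (fun l => n (pickle (map k l))); split=> [l _|l m nl nm].
    by exists (pickle (map k l)).
  move=> /nI/(pcan_inj pickleK); apply: (map_inj_on (range n)) => // x y.
  by move=> /kP {2}<- /kP {2}<- ->.
have [f0 nf0] := n_code.
pose S := {p : set K * (seq K -> K) | list_coding p.1 p.2}.
pose R (s t : S) := `[< (sval s).1 `<=` (sval t).1 /\
  forall l, all (mem (sval s).1) l -> (sval t).2 l = (sval s).2 l >].
have [|||[[A f] /= Af] Amax] := @ZL_preorder S (exist _ (range n, f0) nf0) R.
- by move=> s; apply/asboolP; split.
- move=> s r t /asboolP[rs ers] /asboolP[st est]; apply/asboolP.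
  split=> [|l rl]; first exact: subset_trans st.
  by rewrite est ?ers //; exact: all_memS rl.
- move=> C Ctot; have [C0|/set0P[s0 Cs0]] := eqVneq C set0.
    by exists (exist _ (range n, f0) nf0); rewrite C0.
  have [|||q qcode qC] := @list_coding_chain K (sval @` C).
  + by move=> _ [s _ <-]; exact: (svalP s).
  + move=> _ _ [s Cs <-] [t Ct <-].
    by have [/asboolP|/asboolP] := Ctot _ _ Cs Ct; [left|right].
  + by exists (sval s0); exists s0.
  by exists (exist _ q qcode) => s Cs; apply/asboolP; apply: qC; exists s.
have A0 : A (f [::]) by exact: Af.1.
have [/card_le_fun[]|/card_le_fun] := card_le_total (~` A) A;
  first by exists (f [::]).
- move=> h [hA hI].
  have [g [gA gI]] := list_coding_absorb A (~` A) f h Af hA hI.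
  have gT l : all (mem A) (map g l).
    by rewrite all_map; apply/allT => x; apply/mem_set/gA; rewrite setUv.
  apply/card_leTP; exists (f \o map g) => l m /= /(Af.2 _ _ (gT l) (gT m)).
  by apply: inj_map => x y; apply: gI; rewrite setUv.
have [[x nAx]|AT] := pselect (~` A !=set0).
  move=> /(_ (ex_intro _ x nAx))[h [hA hI]].
  have [f' [f'code f'E]] := list_coding_extend A f h Af hA hI.
  have /asboolP[/= BA _] : R (exist _ (A `|` h @` A, f') f'code) (exist _ (A, f) Af).
    by apply: Amax; apply/asboolP; split=> //=; exact: subsetUl.
  by case: (hA (f [::])) => //; apply: BA; right; exists (f [::]).
have allA l : all (mem A) l.
  by apply/allT => x; apply/mem_set; apply: contrapT => nAx; apply: AT; exists x.
by move=> _; apply/card_leTP; exists f => l m; apply: Af.2.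
Qed.

(** * Characters and indexed local bases *)

(** Repetitions are allowed in the family, so an index type only has to be at
least as large as a base. *)
Definition indexed_nbhs_base {Y : topologicalType} {I : Type} (y : Y)
    (b : I -> set Y) :=
  (forall i, nbhs y (b i)) /\ forall N, nbhs y N -> exists i, b i `<=` N.

Lemma min_nbhs_base_cardP {Y : topologicalType} (y : Y) (I : Type) :
  min_nbhs_base y #<= [set: I] <->
  exists b : I -> set Y, indexed_nbhs_base y b.
Proof.
have [[Bnbhs Bsub] Bmin] := svalP (cid (min_nbhs_base_exists y)).
split=> [/card_le_range[|b bB]|[b [b_nbhs bsub]]].
- by have [U BU _] := Bsub _ filterT; exists U.
- exists b; split=> [i|N /Bsub[U]].
    by apply: Bnbhs; rewrite -[sval _]bB; exists i.
  by rewrite -[sval _]bB => -[i _ <-] bN; exists i.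
apply: card_le_trans (card_image_le b setT); apply: Bmin.
split=> [_ [i _ <-] //|N /bsub[i biN]].
by exists (b i) => //; exists i.
Qed.

Lemma character_leP (Y : topologicalType) (L : Type) :
  [set: character Y] #<= [set: L] <->
  forall y : Y, [set: character_at y] #<= [set: L].
Proof.
have [supU supL] := svalP (cid (card_sup_exists (@character_at Y))).
split=> [YL y|]; last exact: supL.
by apply: card_le_trans YL; apply: supU.
Qed.

Lemma character_at_leP (Y : topologicalType) (y : Y) (L : Type) :
  [set: character_at y] #<= [set: L] <->
  [set: nat] #<= [set: L] /\ exists b : L -> set Y, indexed_nbhs_base y b.
Proof.
rewrite -min_nbhs_base_cardP -(card_le_eql (card_setT (min_nbhs_base y))).
split=> [/card_leTP[f fI]|[natL /card_leTP[g gI]]].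
  split; apply/card_leTP; [exists (f \o inl)|exists (f \o inr)] => u v /fI;
    by case.
have /card_leTP[e eI] := card_seq_le L natL.
(* Lists of length at least 2 code the summand nat and lists of length 1 code
   the base, so that the two sets of codes are disjoint. *)
pose a := e [::].
apply/card_leTP; exists (fun u => match u with
  | inl n => e (nseq n.+2 a) | inr U => e [:: g U] end) => -[m|U] [n|V] /eI //.
- by move=> /(congr1 size); rewrite !size_nseq => -[->].
- by move=> [/gI ->].
Qed.

(** * Finite unions of convergent sequences *)

Lemma fin_union_seq_countable (X : topologicalType) (S : set X) :
  is_fin_union_seq S -> countable S.
Proof.
move=> [_ [r [C [Cseq ->]]]]; apply: bigcup_countable => // i _.
have [u [x [_ ->]]] := Cseq i.
rewrite -bigcup2E; apply: bigcup_countable => // -[|[|n]] _ //=.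
exact: card_image_le.
Qed.

(** Compactness in pointwise form: for each sequence, the neighbourhood of its
limit takes care of all but the first [N] terms, which are listed one by one. *)
Lemma fin_union_seq_nbhs_cover (X : topologicalType) (S : set X) (U : X -> set X) :
  is_fin_union_seq S -> (forall x, S x -> nbhs x (U x)) ->
  exists l : seq X, (forall x, x \in l -> S x) /\
    forall y, S y -> exists2 x, x \in l & U x y.
Proof.
move=> [_ [r [C [Cseq ->]]]] nbhsU.
have /choice[l lP] i : exists l : seq X, (forall x, x \in l -> C i x) /\
    forall y, C i y -> exists2 x, x \in l & U x y.
  have CU x : C i x -> nbhs x (U x) by move=> Cx; apply: nbhsU; exists i.
  have [u [x [ux CE]]] := Cseq i; rewrite {}CE in CU *.
  have [N _ NU] : \forall n \near \oo, U x (u n) by apply/ux/CU; right.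
  exists (x :: map u (iota 0 N)); split=> [y|y].
    by rewrite inE => /orP[/eqP->|/mapP[n _ ->]]; [right|left; exists n].
  move=> Cy; case: (Cy) => [[n _ uny]|yx]; last first.
    exists x; [exact: mem_head|rewrite yx].
    by apply: nbhs_singleton; apply: CU; right.
  have [Nn|nN] := leqP N n.
    by exists x; [exact: mem_head|rewrite -uny; exact: NU].
  exists y; last by apply: nbhs_singleton; apply: CU.
  by rewrite inE -uny map_f ?orbT // mem_iota.
exists (flatten (map l (enum 'I_r))); split=> [x|y [i _]].
  by move=> /flatten_mapP[i _ /(lP i).1 Cx]; exists i.
move=> /(lP i).2[x lx Ux]; exists x => //.
by apply/flatten_mapP; exists i; rewrite ?mem_enum.
Qed.

(** * Local bases of the hyperspace *)

(** The box [vietoris_box] with its open sets given by a list, so that refining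
and merging families amounts to mapping and concatenating lists. *)
Definition vietoris_seq_box {X : topologicalType} (l : seq (set X)) :
    set (seq_hyperspace X) :=
  [set S : seq_hyperspace X |
    (forall x, (S : set X) x -> exists2 V, V \in l & V x) /\
    forall V, V \in l -> (S : set X) `&` V !=set0].

Lemma vietoris_seq_boxE {X : topologicalType} (l : seq (set X)) :
  vietoris_seq_box l = vietoris_box (tnth (in_tuple l)).
Proof.
apply/seteqP; split=> S [Scov Smeet]; split.
- by move=> x /Scov[V /(tnthP (in_tuple l))[i ->] Vx]; exists i.
- by move=> i; apply: Smeet; exact: mem_tnth.
- by move=> x /Scov[i _ ix]; exists (tnth (in_tuple l) i) => //; exact: mem_tnth.
- by move=> V /(tnthP (in_tuple l))[i ->]; exact: Smeet.
Qed.

Lemma nbhs_vietorisP {X : topologicalType} (S : seq_hyperspace X) N :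
  nbhs S N <-> exists W, [/\ vietoris_base W, W S & W `<=` N].
Proof.
rewrite nbhsE; split=> [[O [[D Dbase <-] [W DW WS]] ON]|[W [Wbase WS WN]]].
  by exists W; split=> //; [exact: Dbase|move=> T WT; apply: ON; exists W].
exists W => //; split=> //; exists [set W]; first by move=> _ ->.
by rewrite bigcup_set1.
Qed.

Lemma nbhs_vietoris_seq_box {X : topologicalType} (S : seq_hyperspace X) l :
  (forall V, V \in l -> open V) -> vietoris_seq_box l S ->
  nbhs S (vietoris_seq_box l).
Proof.
move=> lopen lS; apply/nbhs_vietorisP; exists (vietoris_seq_box l); split=> //.
rewrite vietoris_seq_boxE; exists (size l), (tnth (in_tuple l)); split=> // i.
by apply: lopen; exact: mem_tnth.
Qed.

(** The set [U x] is the intersection of the given [W j] that contain [x].  A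
finite subcover of [S] by sets [V x] inside [U x] stays within the union of
the [W j]; adding [V x] for one point [x] of [S] in each [W j] makes every
member of the box meet all of them. *)
Lemma vietoris_seq_box_refine {X : topologicalType} (S : seq_hyperspace X) N :
  nbhs S N ->
  exists2 U : X -> set X, forall x, nbhs x (U x) &
    forall V : X -> set X,
      (forall x, (S : set X) x -> nbhs x (V x) /\ V x `<=` U x) ->
      exists2 l : seq X, forall x, x \in l -> (S : set X) x &
        vietoris_seq_box (map V l) S /\ vietoris_seq_box (map V l) `<=` N.
Proof.
move=> /nbhs_vietorisP[_ [[r [W [Wopen ->]]] [SW WS] WN]].
exists (fun x => [set y | forall j, W j x -> W j y]) => [x|V VS].
  apply: filter_forall => j; have [Wx|nWx] := pselect (W j x).
    by apply: filterS (open_nbhs_nbhs (conj (Wopen j) Wx)) => y Wy _.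
  by apply: filterE => y /nWx.
have [l [lS lcov]] := fin_union_seq_nbhs_cover X S V (seq_hyperspaceP S)
  (fun x Sx => (VS x Sx).1).
have /choice[w wP] := WS.
pose m := l ++ map w (enum 'I_r).
have mS x : x \in m -> (S : set X) x.
  by rewrite mem_cat => /orP[/lS //|/mapP[j _ ->]]; exact: (wP j).1.
exists m => //; split.
  split=> [y /lcov[x lx Vx]|_ /mapP[x /mS Sx ->]].
    by exists (V x) => //; rewrite map_f // mem_cat lx.
  by exists x; split=> //; exact: nbhs_singleton (VS x Sx).1.
move=> T [Tcov Tmeet]; apply: WN; split=> [y /Tcov[_ /mapP[x /mS Sx ->]]|j].
  by move=> /(VS x Sx).2 Uy; have [j _ Wx] := SW x Sx; exists j => //; exact: Uy.
have [|y [Ty Vy]] := Tmeet (V (w j)).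
  by rewrite map_f // mem_cat map_f ?orbT // mem_enum.
by exists y; split=> //; exact: (VS _ (wP j).1).2 (wP j).2.
Qed.

(** The countable set [S] is enumerated by [K], so a pair in [K * K] names a basic
neighbourhood of a point of [S], and a list of such pairs names a box. *)
Lemma hyperspace_indexed_base {X : topologicalType} {K : Type} (b : X -> K -> set X)
    (S : seq_hyperspace X) :
  [set: nat] #<= [set: K] -> (forall x, indexed_nbhs_base x (b x)) ->
  exists B : K -> set (seq_hyperspace X), indexed_nbhs_base S B.
Proof.
move=> natK bbase; apply/min_nbhs_base_cardP.
have seqK := card_seq_le K natK.
have SK : (S : set X) #<= [set: K].
  exact: card_le_trans (fin_union_seq_countable X S (seq_hyperspaceP S)) natK.
have [s sS] := card_le_range SK (seq_hyperspaceP S).1.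
have codeK : [set: seq (K * K)] #<= [set: K].
  have /card_leTP[e eI] := seqK; apply/card_leTP.
  exists (fun m => e [seq e [:: p.1; p.2] | p <- m]) => m m' /eI.
  by apply: inj_map => -[x y] [x' y'] /eI[-> ->].
suff : min_nbhs_base S #<= [set: seq (K * K)] by move=> /card_le_trans; apply.
apply/min_nbhs_base_cardP.
pose box (m : seq (K * K)) := vietoris_seq_box [seq (b (s p.1) p.2)° | p <- m].
have boxS m : box m S -> nbhs S (box m).
  move=> mS; apply: nbhs_vietoris_seq_box => // V.
  elim: m {mS} => //= p m IH; rewrite inE => /orP[/eqP->|//].
  exact: open_interior.
(* A box that does not contain S is replaced by the whole space. *)
exists (fun m => if `[< box m S >] then box m else setT).
split=> [m|N /vietoris_seq_box_refine[U nbhsU UN]].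
  by case: asboolP => [/boxS|_]; [|exact: filterT].
have /choice[k kU] x : exists i, b x i `<=` U x by exact: (bbase x).2.
have /choice[c cS] x : exists i, (S : set X) x -> s i = x.
  have [k0] : exists i : K, True by have /card_leTP[n _] := natK; exists (n 0).
  have [|nSx] := pselect ((S : set X) x); last by exists k0.
  by rewrite -{1}sS => -[i _ <-]; exists i.
have [x Sx|l lS [Sl lN]] := UN (fun x => (b x (k x))°).
  split; first by apply: nbhs_interior; exact: (bbase x).1.
  exact: subset_trans (@interior_subset _ _) (kU x).
have boxE : box [seq (c x, k x) | x <- l] =
    vietoris_seq_box [seq (b x (k x))° | x <- l].
  rewrite /box -map_comp; congr vietoris_seq_box.
  by apply/eq_in_map => x /lS/cS /= ->.
by exists [seq (c x, k x) | x <- l]; rewrite boxE asboolT.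
Qed.

(** * Points as elements of the hyperspace *)

Lemma is_fin_union_seq1 {X : topologicalType} (x : X) : is_fin_union_seq [set x].
Proof.
split; first by exists x.
exists 1, (fun=> [set x]); split=> [_|].
  exists (fun=> x), x; split; first exact: cvg_cst.
  by apply/seteqP; split=> y; [right|case=> // -[n _ <-]].
by apply/seteqP; split=> y => [yx|[]//]; exists ord0.
Qed.

Definition hyperspace_point {X : topologicalType} (x : X) : seq_hyperspace X :=
  SeqHyperspace (is_fin_union_seq1 x).

Lemma hyperspace_point_box {X : topologicalType} (r : nat) (U : 'I_r -> set X) x :
  vietoris_box U (hyperspace_point x) <-> (0 < r)%N /\ forall i, U i x.
Proof.
split=> [[cov meet]|[r0 Ux]]; split.
- by have [i _ _] := cov x erefl; exact: leq_ltn_trans (ltn_ord i).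
- by move=> i; have [_ [-> ]] := meet i.
- by move=> _ ->; exists (Ordinal r0).
- by move=> i; exists x.
Qed.

Lemma nbhs_hyperspace_point {X : topologicalType} (x : X) W :
  nbhs (hyperspace_point x) W -> nbhs x (hyperspace_point @^-1` W).
Proof.
move=> /nbhs_vietorisP[_ [[r [U [Uopen ->]]] /hyperspace_point_box[r0 Ux] UW]].
have : nbhs x [set y | forall i, U i y].
  by apply: filter_forall => i; exact: open_nbhs_nbhs.
by apply: filterS => y Uy; apply/UW/hyperspace_point_box.
Qed.

(** The point map is continuous, and it is an embedding because the box of a
single open set [V] meets its range exactly in the points of [V]. *)
Lemma hyperspace_point_indexed_base {X : topologicalType} {I : Type} (x : X)
    (B : I -> set (seq_hyperspace X)) :
  indexed_nbhs_base (hyperspace_point x) B ->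
  indexed_nbhs_base x (fun i => hyperspace_point @^-1` (B i)).
Proof.
move=> [Bnbhs Bsub]; split=> [i|N xN]; first exact: nbhs_hyperspace_point.
pose box := vietoris_box (fun _ : 'I_1 => N°).
have /Bsub[i Bi] : nbhs (hyperspace_point x) box.
  apply/nbhs_vietorisP; exists box; split=> //; last exact/hyperspace_point_box.
  by exists 1, (fun=> N°); split=> // _; exact: open_interior.
exists i => y /Bi /hyperspace_point_box[_ /(_ ord0)].
exact: interior_subset.
Qed.

Theorem theorem4p4 (X : topologicalType) (hX : hausdorff_space X) :
  [set: character (seq_hyperspace X)] #= [set: character X].
Proof.
have char_at (Y : topologicalType) (y : Y) :=
  (character_leP Y (character Y)).1 (card_lexx _) y.
rewrite card_eq_le; apply/andP; split; apply/character_leP; last first.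
  move=> x; have /character_at_leP[natK [B xB]] := char_at _ (hyperspace_point x).
  apply/character_at_leP; split=> //.
  by exists (fun i => hyperspace_point @^-1` (B i));
    exact: hyperspace_point_indexed_base.
move=> S; have [[x0 _] _] := seq_hyperspaceP S.
have /character_at_leP[natK _] := char_at _ x0.
have /choice[b bP] x : exists b : character X -> set X, indexed_nbhs_base x b.
  by have /character_at_leP[] := char_at _ x.
by apply/character_at_leP; split=> //; exact: hyperspace_indexed_base bP.
Qed.
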